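(* Let $\mathcal T=[\mathbf A,\mathbf B,\mathbf C]_R$ with $\mathbf A\in\mathbb F^{I\times R}$, $\mathbf B\in\mathbb F^{J\times R}$, $\mathbf C\in\mathbb F^{K\times R}$, and let $$m_{\mathbf A}:=R-r_{\mathbf A}+2,\quad m_{\mathbf B}:=R-r_{\mathbf B}+2,\quad m_{\mathbf C}:=R-r_{\mathbf C}+2.$$ Assume that at least two of the following three conditions hold: (i) condition $U_{m_{\mathbf A}}$ holds for $\mathbf B$ and $\mathbf C$; (ii) condition $U_{m_{\mathbf B}}$ holds for $\mathbf C$ and $\mathbf A$; (iii) condition $U_{m_{\mathbf C}}$ holds for $\mathbf A$ and $\mathbf B$, where condition $U_m$ holds for matrices $\mathbf X,\mathbf Y$ with $R$ columns if, for every $\mathbf d\in\mathbb F^R$, $(\mathcal C_m(\mathbf X)\odot\mathcal C_m(\mathbf Y))\,\widehat{\mathbf d}^m=\mathbf 0$ implies $\widehat{\mathbf d}^m=\mathbf 0$. Then $r_{\mathcal T}=R$ and the CPD of $\mathcal T$ is unique.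
   Context: $\mathbb F$ is $\mathbb R$ or $\mathbb C$. For matrices $\mathbf A,\mathbf B,\mathbf C$ with $R$ nonzero columns each, $[\mathbf A,\mathbf B,\mathbf C]_R:=\sum_{r=1}^R\mathbf a_r\circ\mathbf b_r\circ\mathbf c_r$ ($\circ$ = outer product). The rank $r_{\mathcal T}$ of a tensor is the minimal number of terms in such a representation; a representation with $R=r_{\mathcal T}$ terms is a canonical polyadic decomposition (CPD). The CPD of a tensor $\mathcal T$ of rank $R$ is unique if $\mathcal T=[\mathbf A,\mathbf B,\mathbf C]_R=[\bar{\mathbf A},\bar{\mathbf B},\bar{\mathbf C}]_R$ implies that there are an $R\times R$ permutation matrix $\mathbf\Pi$ and nonsingular diagonal matrices $\mathbf\Lambda_{\mathbf A},\mathbf\Lambda_{\mathbf B},\mathbf\Lambda_{\mathbf C}$ with $\bar{\mathbf A}=\mathbf A\mathbf\Pi\mathbf\Lambda_{\mathbf A}$, $\bar{\mathbf B}=\mathbf B\mathbf\Pi\mathbf\Lambda_{\mathbf B}$, $\bar{\mathbf C}=\mathbf C\mathbf\Pi\mathbf\Lambda_{\mathbf C}$, $\mathbf\Lambda_{\mathbf A}\mathbf\Lambda_{\mathbf B}\mathbf\Lambda_{\mathbf C}=\mathbf I_R$. $r_{\mathbf M}$ is the rank of a matrix $\mathbf M$. $\odot$ is the Khatri-Rao (column-wise Kronecker) product. For $\mathbf M\in\mathbb F^{p\times R}$ the $k$-th compound matrix $\mathcal C_k(\mathbf M)$ is the $\binom pk\times\binom Rk$ matrix of all $k\times k$ minors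 of $\mathbf M$, with row and column index sets ordered lexicographically; it is defined for $k\le\min(p,R)$, and a condition involving compound matrices is understood to include that they are defined (so $U_m$ for $\mathbf X,\mathbf Y$ includes that $m$ is at most $R$ and at most the numbers of rows of $\mathbf X$ and $\mathbf Y$). For $\mathbf d=[d_1\ \dots\ d_R]^T$, $\widehat{\mathbf d}^m\in\mathbb F^{\binom Rm}$ is the vector of all products $d_{i_1}\cdots d_{i_m}$, $1\le i_1<\dots<i_m\le R$, in lexicographic order. *)

(* Defs.v *)
From mathcomp Require Import all_boot all_order all_algebra.
From mathcomp Require Import reals.
From mathcomp Require Import complex mxtens.
Set Implicit Arguments.
Unset Strict Implicit.
Unset Printing Implicit Defensive.
Import Order.Theory GRing.Theory Num.Theory.
Local Open Scope ring_scope.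

Variant scalar_kind := RealScalars | ComplexScalars.

Definition scalars (R : realType) (k : scalar_kind) : fieldType :=
  match k with
  | RealScalars => R
  | ComplexScalars => R[i]%C
  end.

(* An I x J x K array is a finite function on the triples of indices; this type
   carries the entrywise addition used in [polyadic]. *)
Definition tensor (F : fieldType) (I J K : nat) :=
  {ffun 'I_I * 'I_J * 'I_K -> F}.

Definition outer (F : fieldType) (I J K : nat)
    (a : 'cV[F]_I) (b : 'cV[F]_J) (c : 'cV[F]_K) : tensor F I J K :=
  [ffun t => a t.1.1 0 * b t.1.2 0 * c t.2 0].

Definition nonzero_cols (F : fieldType) (p n : nat) (M : 'M[F]_(p, n)) : Prop :=
  forall r : 'I_n, col r M != 0.

(* The sum [A, B, C]_n, without the requirement that the columns be nonzero,
   which is carried by [is_polyadic]. *)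
Definition polyadic (F : fieldType) (I J K n : nat)
    (A : 'M[F]_(I, n)) (B : 'M[F]_(J, n)) (C : 'M[F]_(K, n)) : tensor F I J K :=
  \sum_(r < n) outer (col r A) (col r B) (col r C).

Definition is_polyadic (F : fieldType) (I J K n : nat) (T : tensor F I J K)
    (A : 'M[F]_(I, n)) (B : 'M[F]_(J, n)) (C : 'M[F]_(K, n)) : Prop :=
  [/\ nonzero_cols A, nonzero_cols B, nonzero_cols C & T = polyadic A B C].

(* Every tensor has a rank, so that this relation is a function of [T]. *)
Definition has_tensor_rank (F : fieldType) (I J K : nat) (T : tensor F I J K)
    (n : nat) : Prop :=
  let representable k :=
    exists (A : 'M[F]_(I, k)) (B : 'M[F]_(J, k)) (C : 'M[F]_(K, k)),
      is_polyadic T A B C in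
  representable n /\ forall k, representable k -> (n <= k)%N.

Definition cpd_unique (F : fieldType) (I J K : nat) (T : tensor F I J K) : Prop :=
  forall (n : nat) (A A' : 'M[F]_(I, n)) (B B' : 'M[F]_(J, n))
         (C C' : 'M[F]_(K, n)),
    has_tensor_rank T n -> is_polyadic T A B C -> is_polyadic T A' B' C' ->
    exists P LA LB LC : 'M[F]_n,
      [/\ is_perm_mx P,
          [/\ is_diag_mx LA, is_diag_mx LB & is_diag_mx LC],
          [/\ LA \in unitmx, LB \in unitmx & LC \in unitmx],
          [/\ A' = A *m P *m LA, B' = B *m P *m LB & C' = C *m P *m LC]
        & LA *m LB *m LC = 1%:M].

Definition khatri_rao (F : fieldType) (p q n : nat)
    (X : 'M[F]_(p, n)) (Y : 'M[F]_(q, n)) : 'M[F]_(p * q, n) :=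
  \matrix_(i, r) tensmx (col r X) (col r Y) i 0.

(* k-subsets of {0, ..., p-1}, as strictly increasing k-tuples; the type
   [k.-tuplelexi 'I_p] is [k.-tuple 'I_p] with its lexicographic order. *)
Definition ksubsets (p k : nat) : {set k.-tuplelexi 'I_p} :=
  [set t : k.-tuplelexi 'I_p | sorted ltn (map val (t : k.-tuple 'I_p))].

Lemma card_ksubsets (p k : nat) : 'C(p, k) = #|ksubsets p k|.
Proof. exact/esym/card_ltn_sorted_tuples. Qed.

(* [Order.enum_val] is increasing, so this is the i-th k-subset in
   lexicographic order. *)
Definition ksubset (p k : nat) (i : 'I_('C(p, k))) : k.-tuple 'I_p :=
  Order.enum_val (cast_ord (card_ksubsets p k) i).

Definition compound (F : fieldType) (p n k : nat) (M : 'M[F]_(p, n)) :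
    'M[F]_('C(p, k), 'C(n, k)) :=
  \matrix_(i, j) \det (mxsub (tnth (ksubset i)) (tnth (ksubset j)) M).

Definition hat (F : fieldType) (n m : nat) (d : 'cV[F]_n) : 'cV[F]_('C(n, m)) :=
  \col_i \prod_(j < m) d (tnth (ksubset i) j) 0.

(* The three inequalities say that both compound matrices are defined; outside
   this range [compound] is a matrix with no rows or no columns. *)
Definition condU (F : fieldType) (m p q n : nat)
    (X : 'M[F]_(p, n)) (Y : 'M[F]_(q, n)) : Prop :=
  [/\ (m <= n)%N, (m <= p)%N, (m <= q)%N
    & forall d : 'cV[F]_n,
        khatri_rao (compound m X) (compound m Y) *m hat m d = 0 -> hat m d = 0].

(* Main.v *)
(** Cauchy-Binet turns [U_m] for [X, Y] into the bound
    [min(w(d), m) <= rank(X Diag(d) Y^T)], where [w(d)] is the number of nonzero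
    entries of [d].

    If [[A, B, C] = [A', B', C']], then contracting the third mode with [x] gives
    [A Diag(C^T x) B^T = A' Diag(C'^T x) B'^T], so the bound for [A, B] with
    [m = m_C] yields [w(C^T x) <= w(C'^T x)] whenever [w(C'^T x) < m_C].  This is
    the hypothesis of Kruskal's permutation lemma.  Its proof is a descending
    induction on the dimension of subspaces [V] spanned by columns of [C']: at
    most as many columns of [C] as of [C'] lie outside [V], by summing the same
    inequality over all the spans of [V] and one further column of [C'].  Applied
    to lines, it gives [C' = C Pi Lambda]; applied to [V = 0], it gives [R <= R'].

    Two of the conditions thus determine two factors, say [B] and [C], up to
    permutations [s] and [t].  If [s r <> t r], some [x] orthogonal to the column
    [s r] of [C] but not to the column [t r] has [w(C^T x) < m_C]; comparing the
    row spaces of the two contractions puts the column [s r] of [B] in the span of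
    at most [m_C - 1] other columns, against the rank bound.  Hence [s = t], and
    the same contractions then determine [A], column by column. *)
Require Import Defs.
From mathcomp Require Import all_boot all_order all_algebra.
From mathcomp Require Import reals.
From mathcomp Require Import perm complex mxtens zify ring.
Set Implicit Arguments.
Unset Strict Implicit.
Unset Printing Implicit Defensive.
Import GRing.Theory.
Local Open Scope ring_scope.

(** * Enumeration of [k]-subsets by increasing tuples *)

Lemma ksubset_sorted (p k : nat) (i : 'I_('C(p, k))) :
  sorted ltn (map val (ksubset i)).
Proof.
by have := Order.EnumVal.enum_valP (cast_ord (card_ksubsets p k) i); rewrite inE.
Qed.

Lemma ksubset_inj (p k : nat) : injective (@ksubset p k).
Proof.
move=> i j eqij; apply: (@cast_ord_inj _ _ (card_ksubsets p k)).
exact: (@Order.enum_val_inj _ _ (ksubsets p k)) eqij.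
Qed.

Lemma tnth_ksubset_inj (p k : nat) (i : 'I_('C(p, k))) :
  injective (tnth (ksubset i)).
Proof.
apply/tuple_uniqP; rewrite -(map_inj_uniq val_inj).
exact: sorted_uniq ltn_trans ltnn _ (ksubset_sorted i).
Qed.

Lemma ksubset_mem_inj (p k : nat) (i j : 'I_('C(p, k))) :
  ksubset i =i ksubset j -> i = j.
Proof.
move=> eqij; apply/ksubset_inj/val_inj/(inj_map val_inj).
apply: (irr_sorted_eq ltn_trans ltnn (ksubset_sorted i) (ksubset_sorted j)).
by move=> x; apply/mapP/mapP => -[y yi ->]; exists y; rewrite // ?eqij // -eqij.
Qed.

(** * The Cauchy-Binet formula *)

Section CauchyBinet.
Variables (F : comNzRingType) (m n : nat).

(** Encodes an injection as a permutation of ['I_m] followed by the increasing enumeration of its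
    image, so that a sum over injections splits into one over subsets and one over permutations. *)
Let inj_of (u : 'I_('C(n, m)) * 'S_m) : {ffun 'I_m -> 'I_n} :=
  [ffun j => tnth (ksubset u.1) (u.2 j)].

Let inj_of_inj : injective inj_of.
Proof.
move=> [i s] [i' s'] /ffunP eqf.
have eqt j : tnth (ksubset i) (s j) = tnth (ksubset i') (s' j).
  by have := eqf j; rewrite !ffunE.
have eqi : i = i'.
  apply: ksubset_mem_inj => x; apply/tnthP/tnthP => -[j ->].
    by exists (s' (s^-1%g j)); rewrite -eqt permKV.
  by exists (s (s'^-1%g j)); rewrite eqt permKV.
rewrite -eqi in eqt *; congr (_, _); apply/permP => j.
exact: tnth_ksubset_inj (eqt j).
Qed.

(** One inclusion and a count: there are ['C(n, m) * m!] injections. *)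
Let imset_inj_of :
  inj_of @: setT = [set f : {ffun 'I_m -> 'I_n} | injectiveb f].
Proof.
apply/eqP; rewrite eqEcard; apply/andP; split.
  apply/subsetP => _ /imsetP[[i s] _ ->]; rewrite inE; apply/injectiveP => j j'.
  by rewrite !ffunE /= => /tnth_ksubset_inj/perm_inj.
rewrite card_imset // cardsT card_prod card_ord card_Sn card_inj_ffuns !card_ord.
by rewrite bin_ffact.
Qed.

(** Multilinearity expands the determinant over all maps [f] choosing a column of [A] for each row.
    A noninjective [f] repeats a row of [B] and contributes 0; over the injections with a given
    image, the signs assemble the minor of [A]. *)
Lemma cauchy_binet (A : 'M[F]_(m, n)) (B : 'M[F]_(n, m)) :
  \det (A *m B) = \sum_(i < 'C(n, m))
    \det (colsub (tnth (ksubset i)) A) * \det (rowsub (tnth (ksubset i)) B).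
Proof.
transitivity (\sum_(f : {ffun 'I_m -> 'I_n})
    (\prod_i A i (f i)) * \det (rowsub f B)).
  rewrite [LHS](eq_bigr (fun s : 'S_m => \sum_(f : {ffun 'I_m -> 'I_n})
      (-1) ^+ s * \prod_i (A i (f i) * B (f i) (s i)))) => [|s _]; last first.
    rewrite -big_distrr /= -(bigA_distr_bigA (fun i j => A i j * B j (s i))).
    by congr (_ * _); apply: eq_bigr => i _; rewrite mxE.
  rewrite exchange_big; apply: eq_bigr => f _ /=; rewrite big_distrr /=.
  apply: eq_bigr => s _; rewrite mulrCA big_split; congr (_ * (_ * _)).
  by apply: eq_bigr => i _; rewrite mxE.
rewrite (bigID (fun f : {ffun 'I_m -> 'I_n} => injectiveb f)) /= addrC.
rewrite big1 ?add0r => [|f /injectivePn[i1 [i2 Di12 Ef12]]]; last first.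
  by rewrite (determinant_alternate Di12) ?mulr0 // => j; rewrite !mxE Ef12.
rewrite (eq_bigl (mem [set f : {ffun 'I_m -> 'I_n} | injectiveb f])) => [|f];
  last first.
  by rewrite [RHS]in_set.
rewrite -imset_inj_of big_imset /=; last by move=> x y _ _; apply: inj_of_inj.
rewrite (eq_bigl predT) => [|x]; last by rewrite in_setT.
rewrite -(pair_bigA _ (fun i s => (\prod_j A j (inj_of (i, s) j)) *
   \det (rowsub (inj_of (i, s)) B))) /=.
apply: eq_bigr => i _; rewrite [RHS]big_distrl /=.
apply: eq_bigr => s _.
have -> : rowsub (inj_of (i, s)) B = row_perm s (rowsub (tnth (ksubset i)) B).
  by apply/matrixP => j l; rewrite !mxE ffunE.
rewrite row_permE det_mulmx det_perm mulrCA mulrA; congr (_ * _ * _).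
by apply: eq_bigr => j _; rewrite !mxE ffunE.
Qed.
End CauchyBinet.

(** * Condition [U_m] as a rank bound *)

Definition supp (F : fieldType) (n : nat) (x : 'cV[F]_n) : {set 'I_n} :=
  [set r | x r 0 != 0].

Lemma ksubset_sub (n m : nat) (S : {set 'I_n}) :
  (m <= #|S|)%N -> exists i : 'I_('C(n, m)), {subset ksubset i <= S}.
Proof.
move=> le_mS; have szt : size (take m (enum S)) == m.
  by rewrite size_take_min -cardE; apply/eqP/minn_idPl.
pose t : m.-tuplelexi 'I_n := Tuple szt.
have tP : t \in ksubsets n m.
  rewrite inE /=; apply: (subseq_sorted ltn_trans _ (iota_ltn_sorted 0 n)).
  rewrite -val_enum_ord; apply/map_subseq/(subseq_trans (take_subseq _ _)).
  by rewrite {1}/enum_mem -enumT filter_subseq.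
exists (cast_ord (esym (card_ksubsets n m)) (Order.enum_rank_in tP t)).
move=> x; rewrite /ksubset cast_ordKV Order.enum_rankK_in //= => /mem_take.
by rewrite mem_enum.
Qed.

Section CompoundRank.
Variable F : fieldType.

(** Cauchy-Binet for [X *m diag_mx d^T] times [Y^T], where scaling the columns multiplies a minor by
    the product of the chosen entries of [d]. The premise of [U_m] thus says that all minors of size
    [m] of [X *m diag_mx d^T *m Y^T] vanish. *)
Lemma compound_khatri_rao (p q n m : nat) (X : 'M[F]_(p, n)) (Y : 'M[F]_(q, n))
    (d : 'cV[F]_n) i j :
  (khatri_rao (compound m X) (compound m Y) *m hat m d) (mxtens_index (i, j)) 0 =
  \det (mxsub (tnth (ksubset i)) (tnth (ksubset j)) (X *m diag_mx d^T *m Y^T)).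
Proof.
rewrite [mxsub _ _ _](_ : _ = rowsub (tnth (ksubset i)) X *m diag_mx d^T *m
   colsub (tnth (ksubset j)) Y^T); last first.
  apply/matrixP => a b; rewrite !mul_mx_diag !mxE.
  by apply: eq_bigr => l _; rewrite !mxE.
rewrite cauchy_binet mxE; apply: eq_bigr => s _.
rewrite !mxE !mxtens_indexK /= mulrAC -[\det (rowsub _ (colsub _ _))]det_tr.
set u := ksubset s; congr (_ * _); last first.
  by congr (\det _); apply/matrixP => a b; rewrite !mxE.
rewrite -[LHS]/(_ * \prod_(k < m) d (tnth u k) 0).
have -> : \prod_(k < m) d (tnth u k) 0 = \det (diag_mx (\row_k d (tnth u k) 0)).
  by rewrite det_diag; apply: eq_bigr => k _; rewrite mxE.
rewrite -det_mulmx; congr (\det _); apply/matrixP => a b.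
by rewrite !mul_mx_diag !mxE.
Qed.

Lemma rank_mxsub_leq (m n p q : nat) (f : 'I_p -> 'I_m) (g : 'I_q -> 'I_n)
   (M : 'M[F]_(m, n)) : (\rank (mxsub f g M) <= \rank M)%N.
Proof.
rewrite mxsubrc; apply: leq_trans (mxrankS (rowsub_sub _ _)) _.
by rewrite -mxrank_tr trmx_mxsub -[leqRHS]mxrank_tr mxrankS ?rowsub_sub.
Qed.

Lemma hat_eq0 (n m : nat) (d : 'cV[F]_n) : hat m d = 0 -> (#|supp d| < m)%N.
Proof.
move=> hd0; rewrite ltnNge; apply/negP => /ksubset_sub[i sub_i].
move/colP/(_ i)/eqP: hd0; rewrite !mxE; apply/negP/prodf_neq0 => j _.
by have := sub_i _ (mem_tnth j _); rewrite inE.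
Qed.

(** The inequality [m <= n] is kept because, for [m = n - \rank C + 2], it forces [\rank C >= 2]. *)
Definition rank_bounded (m p q n : nat) (X : 'M[F]_(p, n)) (Y : 'M[F]_(q, n)) :=
  (m <= n)%N /\
  forall d : 'cV[F]_n, (minn #|supp d| m <= \rank (X *m diag_mx d^T *m Y^T))%N.

Lemma rank_bounded_sym (m p q n : nat) (X : 'M[F]_(p, n)) (Y : 'M[F]_(q, n)) :
  rank_bounded m X Y -> rank_bounded m Y X.
Proof.
by case=> le_mn XY; split=> // d; rewrite -mxrank_tr !trmx_mul tr_diag_mx trmxK mulmxA.
Qed.

Lemma condU_rank_bounded (m p q n : nat) (X : 'M[F]_(p, n)) (Y : 'M[F]_(q, n)) :
  condU m X Y -> rank_bounded m X Y.
Proof.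
move=> [le_mn _ _ UXY]; split=> // d.
(* Rank below [m] kills every minor of size [m], so [U_m] gives [hat m e = 0], that is, fewer than
   [m] nonzero entries. *)
have rankP e : (\rank (X *m diag_mx e^T *m Y^T) < m)%N -> (#|supp e| < m)%N.
  move=> lt_rm; apply/hat_eq0/UXY/colP => k.
  case: (mxtens_indexP k) => i j; rewrite compound_khatri_rao mxE.
  apply/eqP; rewrite -[_ == 0]negbK -unitfE -[_ \is a _]/(_ \in unitmx) -row_full_unit.
  apply/eqP => rk; have := rank_mxsub_leq (tnth (ksubset i)) (tnth (ksubset j)) _.
  move=> /(_ (X *m diag_mx e^T *m Y^T))/leq_ltn_trans/(_ lt_rm).
  by rewrite rk ltnn.
case: (leqP m #|supp d|) => [le_md | lt_dm].
  by rewrite leqNgt; apply/negP => /rankP; rewrite ltnNge le_md.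
(* Filling in one zero entry of [d] raises the rank by at most one. *)
move: {2}(m - _)%N (erefl (m - #|supp d|)%N) => k.
elim: k d lt_dm => [|k IHk] d lt_dm def_k.
  by move/eqP: def_k; rewrite subn_eq0 leqNgt lt_dm.
have [r dr0] : exists r, r \notin supp d.
  apply/existsP; rewrite -negb_forall; apply/negP => /forallP full.
  by move: lt_dm; rewrite (eq_card full) card_ord ltnNge le_mn.
pose e := d + delta_mx r 0.
have supp_e : supp e = r |: supp d.
  apply/setP => s; rewrite !inE !mxE eqxx andbT; have [-> | _] := eqVneq s r.
    by move: dr0; rewrite inE negbK => /eqP->; rewrite add0r oner_eq0.
  by rewrite addr0.
have card_e : #|supp e| = #|supp d|.+1 by rewrite supp_e cardsU1 dr0.
have rk_e : (\rank (X *m diag_mx e^T *m Y^T) <=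
             (\rank (X *m diag_mx d^T *m Y^T)).+1)%N.
  have -> : diag_mx e^T = diag_mx d^T + delta_mx r r.
    apply/matrixP => a b; rewrite !mxE eqxx andbT mulrnDl; congr (_ + _).
    have [<- | ne_ab] := eqVneq a b; first by rewrite andbb.
    case: (eqVneq a r) ne_ab => [-> | //]; rewrite eq_sym.
    by move/negPf->.
  rewrite mulmxDr mulmxDl; apply: leq_trans (mxrank_add _ _) _.
  rewrite -[leqRHS]addn1 leq_add2l; apply: leq_trans (mxrankM_maxl _ _) _.
  by apply: leq_trans (mxrankM_maxr _ _) _; rewrite mxrank_delta.
rewrite -ltnS; apply: leq_trans rk_e.
(* Once the support has [m] elements, [rankP] bounds the rank below by [m]; until then the induction
   on the number of missing entries continues. *)
have [le_me | lt_em] := leqP m #|supp e|.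
  apply: leq_trans lt_dm _; rewrite leqNgt; apply/negP => /rankP.
  by rewrite ltnNge le_me.
rewrite -card_e; apply: IHk => //; rewrite card_e subnS def_k //.
Qed.

End CompoundRank.

(** * Subspaces spanned by rows *)

Section Spans.
Variables (F : fieldType) (K : nat).
Implicit Types V W : 'M[F]_K.

Lemma rank_adds_row V (v : 'rV[F]_K) :
  ~~ (v <= V)%MS -> \rank (V + v)%MS = (\rank V).+1.
Proof.
move=> v'V; apply/eqP; rewrite eqn_leq; apply/andP; split.
  apply: leq_trans (mxrank_adds_leqif V v) _.
  by rewrite -[leqRHS]addn1 leq_add2l rank_leq_row.
by rewrite (ltn_leqif (mxrank_leqif_sup (addsmxSl V v))) addsmx_sub submx_refl.
Qed.

Definition outside (n : nat) (M : 'M[F]_(n, K)) V : {set 'I_n} :=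
  [set i | ~~ (row i M <= V)%MS].

Definition row_span (n : nat) (M : 'M[F]_(n, K)) (S : {set 'I_n}) : 'M[F]_K :=
  (\sum_(i in S) <<row i M>>)%MS.

Lemma rank_row_span (n : nat) (M : 'M[F]_(n, K)) S : (\rank (row_span M S) <= #|S|)%N.
Proof.
apply: leq_trans (mxrank_sum_leqif _) _ => /=; rewrite -sum1_card.
by apply: leq_sum => i _; rewrite mxrank_gen rank_leq_row.
Qed.

Lemma row_sub_span (n : nat) (M : 'M[F]_(n, K)) (S : {set 'I_n}) i :
  i \in S -> (row i M <= row_span M S)%MS.
Proof. by move=> iS; apply: (sumsmx_sup i) => //; rewrite genmxE. Qed.

Lemma row_span_subP (n : nat) (M : 'M[F]_(n, K)) (S : {set 'I_n}) V :
  reflect (forall i, i \in S -> (row i M <= V)%MS) (row_span M S <= V)%MS.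
Proof.
by apply: (iffP sumsmx_subP) => sub i /sub; rewrite genmxE.
Qed.

(** Only one inclusion is stated, since the rows of [M] that are not outside [V] lie in [V]
    anyway. *)
Definition spanned (n : nat) (M : 'M[F]_(n, K)) V :=
  (V <= row_span M (~: outside M V))%MS.

Lemma spanned_sub (n : nat) (M : 'M[F]_(n, K)) V : spanned M V -> (V <= M)%MS.
Proof.
move=> spV; apply: submx_trans spV _; apply/sumsmx_subP => i _.
by rewrite genmxE row_sub.
Qed.

Lemma card_outside (n : nat) (M : 'M[F]_(n, K)) V :
  spanned M V -> (#|outside M V| + \rank V <= n)%N.
Proof.
move=> spV; rewrite -[leqRHS]card_ord -(cardsC (outside M V)) leq_add2l.
exact: leq_trans (mxrankS spV) (rank_row_span _ _).
Qed.

Lemma spanned0 (n : nat) (M : 'M[F]_(n, K)) : spanned M 0.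
Proof. exact: sub0mx. Qed.

Lemma spanned_adds (n : nat) (M : 'M[F]_(n, K)) V j :
  spanned M V -> spanned M (V + row j M)%MS.
Proof.
move=> spV; rewrite /spanned addsmx_sub; apply/andP; split; last first.
  by apply: row_sub_span; rewrite !inE negbK addsmxSr.
apply: submx_trans spV _; apply/row_span_subP => i.
rewrite !inE negbK => iV; apply: row_sub_span.
by rewrite !inE negbK (submx_trans iV) ?addsmxSl.
Qed.

Lemma eqmx_outside (n : nat) (M : 'M[F]_(n, K)) V W :
  (V :=: W)%MS -> outside M V = outside M W.
Proof. by move=> eqVW; apply/setP => i; rewrite !inE eqVW. Qed.

(** Modulo [V], the space [V + v] is a line; a coordinate of the quotient map [cokermx V] that is
    nonzero at [v] therefore vanishes on this space exactly along [V]. *)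
Lemma separating_functional V (v : 'rV[F]_K) : ~~ (v <= V)%MS ->
  exists x : 'cV[F]_K, forall n (M : 'M[F]_(n, K)),
    (M <= V + v)%MS -> supp (M *m x) = outside M V.
Proof.
rewrite submxE => /rV0Pn[j nz_j]; exists (col j (cokermx V)) => n M leM.
apply/setP => i; rewrite !inE; congr (~~ _).
have /sub_addsmxP[[a b] /= def_i] := submx_trans (row_sub i M) leM.
have def_c : row i M *m cokermx V = b 0 0 *: (v *m cokermx V).
  by rewrite def_i mulmxDl -mulmxA mulmx_coker mulmx0 add0r [b]mx11_scalar
    mul_scalar_mx -scalemxAl mxE eqxx.
have -> : (M *m col j (cokermx V)) i 0 = (row i M *m cokermx V) 0 j.
  by rewrite colE mulmxA -colE -row_mul !mxE.
rewrite submxE def_c mxE mulf_eq0 (negPf nz_j) orbF scaler_eq0.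
case: eqP => //= _; apply/esym/negbTE/eqP => v0.
by move: nz_j; rewrite v0 mxE eqxx.
Qed.

Lemma separating_row (n : nat) (M : 'M[F]_(n, K)) (S : {set 'I_n}) i :
    ~~ (row i M <= row_span M S)%MS ->
  exists x : 'cV[F]_K, [/\ (#|supp (M *m x)| <= n - \rank M + 1)%N,
    i \in supp (M *m x) & forall j, j \in S -> j \notin supp (M *m x)].
Proof.
move=> i'S; pose P (S' : {set 'I_n}) := ~~ (row i M <= row_span M S')%MS.
(* The rows indexed by a maximal such set [S'] span a hyperplane of the row
   space of [M], whose equation is [x]. *)
have [S' /maxsetP[PS' maxS'] sub_SS'] := @maxset_exists _ P S i'S.
set V := row_span M S' in PS'.
have le_MVi : (M <= V + row i M)%MS.
  apply/row_subP => r; have [rV | r'V] := boolP (row r M <= V)%MS.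
    exact: submx_trans rV (addsmxSl _ _).
  have le_Vr : (V <= V + row r M)%MS := addsmxSl _ _.
  have : (row i M <= V + row r M)%MS.
    apply: contraR r'V => i'Vr; have eqS : r |: S' = S'.
      apply: maxS'; rewrite ?subsetUr //; apply: contra i'Vr => /submx_trans.
      apply; apply/row_span_subP => s /setU1P[-> | sS']; first exact: addsmxSr.
      exact: submx_trans (row_sub_span _ sS') le_Vr.
    by rewrite /V -eqS row_sub_span ?setU11.
  move=> iVr; have leV : (V + row i M <= V + row r M)%MS.
    by rewrite addsmx_sub le_Vr iVr.
  suff : (V + row r M <= V + row i M)%MS by apply: submx_trans; exact: addsmxSr.
  by rewrite -(geq_leqif (mxrank_leqif_sup leV)) !rank_adds_row.
have spV : spanned M V.
  apply/row_span_subP => s sS'; apply: row_sub_span.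
  by rewrite !inE negbK row_sub_span.
have [x supp_x] := separating_functional PS'.
exists x; rewrite supp_x //; split=> [||j jS].
(* [V] has rank at least [\rank M - 1] and is spanned by rows of [M], so at most [n - \rank M + 1]
   rows are outside it, one less than the [m] of the rank bounds used later. *)
- have := card_outside spV; have := mxrankS le_MVi; rewrite rank_adds_row // => le1 le2.
  rewrite -/V; lia.
- by rewrite inE.
- by rewrite inE negbK row_sub_span // (subsetP sub_SS').
Qed.

End Spans.

(** * Linear independence of columns from the rank bound *)

Section RankBounded.
Variable F : fieldType.

Lemma rank_diag_mx (n : nat) (d : 'cV[F]_n) : (\rank (diag_mx d^T) <= #|supp d|)%N.
Proof.
apply: leq_trans (rank_row_span 1%:M (supp d)); apply/mxrankS/row_subP => i.
rewrite row_diag_mx -row1 mxE; have [->|nz] := eqVneq (d i 0) 0.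
  by rewrite scale0r sub0mx.
by apply/scalemx_sub/row_sub_span; rewrite inE.
Qed.

Lemma rank_slice (p q n : nat) (X : 'M[F]_(p, n)) (Y : 'M[F]_(q, n)) (d : 'cV[F]_n) :
  (\rank (X *m diag_mx d^T *m Y^T) <= #|supp d|)%N.
Proof.
apply: leq_trans (mxrankM_maxl _ _) _; apply: leq_trans (mxrankM_maxr _ _) _.
exact: rank_diag_mx.
Qed.

(** With [D = diag_mx u^T], the bound gives [\rank (D *m Y^T) >= #|supp u| >= \rank D], so [Y^T]
    kills no nonzero vector of the row space of [D]. In short, any [m] columns of [Y] are
    independent. *)
Lemma rank_bounded_indep (m p q n : nat) (X : 'M[F]_(p, n)) (Y : 'M[F]_(q, n))
    (u : 'cV[F]_n) :
  rank_bounded m X Y -> Y *m u = 0 -> (#|supp u| <= m)%N -> u = 0.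
Proof.
move=> [_ /(_ u) rkXY] Yu0 /minn_idPl le_um; rewrite le_um in rkXY.
(* [u^T] itself is in the row space of [diag_mx u^T] and in the kernel of [Y^T]. *)
have := mxrank_mul_ker (diag_mx u^T) Y^T.
have le1 : (#|supp u| <= \rank (diag_mx u^T *m Y^T))%N.
  by apply: leq_trans rkXY _; rewrite -mulmxA mxrankM_maxr.
move=> /eqP; set c := \rank (_ :&: _)%MS => def_rk.
have /eqP c0 : c == 0%N.
  have := leq_trans (eq_leq (eqP def_rk)) (leq_trans (rank_diag_mx u) le1).
  by rewrite -[leqRHS]addn0 leq_add2l leqn0.
have : (u^T <= diag_mx u^T :&: kermx Y^T)%MS.
  rewrite sub_capmx; apply/andP; split; last first.
    by apply/sub_kermxP; rewrite -trmx_mul Yu0 trmx0.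
  apply/submxP; exists (const_mx 1); apply/rowP => j.
  by rewrite mul_mx_diag !mxE mul1r.
move/eqP: c0; rewrite mxrank_eq0 => /eqP->; rewrite submx0 => /eqP u0.
by rewrite -[u]trmxK u0 trmx0.
Qed.

(** Otherwise [w - delta_mx i 0] would be a nontrivial relation among at most [m] columns of [Y]. *)
Lemma rank_bounded_col (m p q n : nat) (X : 'M[F]_(p, n)) (Y : 'M[F]_(q, n))
    (w : 'cV[F]_n) i :
  rank_bounded m X Y -> col i Y = Y *m w -> (#|supp w| < m)%N -> i \in supp w.
Proof.
move=> XY def_i lt_wm; apply: contraT => i'w.
have w0 : w - delta_mx i 0 = 0.
  apply: rank_bounded_indep XY _ _; first by rewrite mulmxBr -colE def_i subrr.
  apply: leq_trans (_ : #|i |: supp w| <= m)%N; last by rewrite cardsU1 i'w.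
  apply/subset_leq_card/subsetP => j; rewrite !inE !mxE eqxx andbT.
  by have [//|_] := eqVneq j i; rewrite subr0.
move: i'w; rewrite inE negbK; move/colP/(_ i): w0.
by rewrite !mxE !eqxx => /eqP; rewrite subr_eq0 => /eqP->; rewrite oner_eq0.
Qed.

Lemma rank_bounded_neq (m p q n : nat) (X : 'M[F]_(p, n)) (Y : 'M[F]_(q, n)) i j :
  rank_bounded m X Y -> (1 < m)%N -> (row i Y^T <= row j Y^T)%MS -> i = j.
Proof.
move=> XY lt1m /sub_rVP[a def_i].
have supp_w : supp (a *: delta_mx j 0 : 'cV_n) \subset [set j].
  apply/subsetP => k; rewrite !inE !mxE eqxx andbT.
  by have [//|_] := eqVneq k j; rewrite mulr0 eqxx.
suff /(subsetP supp_w)/set1P : i \in supp (a *: delta_mx j 0 : 'cV_n) by [].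
apply: rank_bounded_col XY _ _; last first.
  by apply: leq_ltn_trans (subset_leq_card supp_w) _; rewrite cards1.
by rewrite -scalemxAr -colE; apply: trmx_inj; rewrite linearZ /= !tr_col.
Qed.

End RankBounded.

(** * The permutation lemma *)

Section PermutationLemma.
Variables (F : fieldType) (K : nat).

(** Double counting of the pairs of a row and a member of [P] not containing it; the common factor
    [size P - 1] is then cancelled. The condition [<<W>>%MS = W] fixes one matrix per subspace, so
    that [uniq P] means distinct subspaces. *)
Lemma leq_outside_cover (n n' : nat) (M : 'M[F]_(n, K)) (N : 'M[F]_(n', K))
    (V : 'M[F]_K) (P : seq 'M[F]_K) :
    uniq P -> (1 < size P)%N ->
    (forall W, W \in P -> [/\ (V <= W)%MS, \rank W = (\rank V).+1 & <<W>>%MS = W]) ->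
    (forall j, j \in outside N V -> exists2 W, W \in P & (row j N <= W)%MS) ->
    (forall W, W \in P -> #|outside M W| <= #|outside N W|)%N ->
  (#|outside M V| <= #|outside N V|)%N.
Proof.
move=> uP gt1P PW PN leMN.
(* A row of [M] outside [V] lies in at most one [W], and a row of [N] outside [V]
   lies in at least one. *)
have sum_outside l (L : 'M[F]_(l, K)) : (\sum_(W <- P) #|outside L W| =
    \sum_(i < l) count (fun W => ~~ (row i L <= W)%MS) P)%N.
  rewrite (eq_bigr (fun W => \sum_(i < l) ~~ (row i L <= W)%MS : nat)%N) => [|W _].
    by rewrite exchange_big; apply: eq_bigr => i _;
      rewrite /= -sumn_count sumnE big_map.
  by rewrite -sum1_card big_mkcond; apply: eq_bigr => i _; rewrite inE; case: (~~ _).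
have countE l (L : 'M[F]_(l, K)) i : (count (fun W => ~~ (row i L <= W)%MS) P =
    size P - count (fun W => row i L <= W)%MS P)%N.
  by rewrite -[size P](count_predC (fun W => row i L <= W)%MS) addKn.
have leM : ((size P).-1 * #|outside M V| <= \sum_(W <- P) #|outside M W|)%N.
  rewrite sum_outside -sum1_card big_distrr /= big_mkcond; apply: leq_sum => i _.
  rewrite inE; case: ifP => // i'V; rewrite muln1 countE -subn1 leq_sub2l //.
  rewrite -size_filter.
  (* By rank, a member of [P] containing row [i] can only be [V + row i M]. *)
  rewrite -[leqRHS]/(size [:: <<(V + row i M)%MS>>%MS]).
  apply: uniq_leq_size; first exact: filter_uniq.
  move=> W; rewrite mem_filter inE => /andP[iW /PW[leVW rkW <-]].
  apply/eqP/esym/eq_genmx.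
  have leW : (V + row i M <= W)%MS by rewrite addsmx_sub leVW.
  by apply/eqmxP; rewrite -(geq_leqif (mxrank_leqif_eq leW)) rank_adds_row ?rkW.
have leN : (\sum_(W <- P) #|outside N W| <= (size P).-1 * #|outside N V|)%N.
  rewrite sum_outside -sum1_card big_distrr /= [leqRHS]big_mkcond.
  apply: leq_sum => j _.
  case: ifP => [/PN[W PW_W jW] | ]; last first.
    rewrite inE => /negbFE jV; rewrite leqn0 -leqn0 -ltnS ltnNge -has_count.
    apply/hasP => -[W /PW[leVW _ _]] /negP; apply; exact: submx_trans jV leVW.
  rewrite muln1 countE -subn1 leq_sub2l // -has_count; apply/hasP; by exists W.
have := leq_trans leM (leq_trans _ leN); rewrite leq_pmul2l -?subn1 ?subn_gt0 //.
apply; rewrite !big_seq; exact: leq_sum.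
Qed.

Variables (n n' : nat) (M : 'M[F]_(n, K)) (N : 'M[F]_(n', K)).
Hypothesis supp_leq : forall x : 'cV[F]_K,
  (#|supp (N *m x)| <= n - \rank M + 1 -> #|supp (M *m x)| <= #|supp (N *m x)|)%N.

(** For [N *m x = 0] the hypothesis forces [M *m x = 0]; the columns of [cokermx N] are such [x]. *)
Lemma supp_leq_sub : (M <= N)%MS.
Proof.
rewrite submxE; apply/eqP/matrixP => i j.
have NC0 : N *m col j (cokermx N) = 0.
  by rewrite colE mulmxA mulmx_coker mul0mx.
have supp0 : #|supp (0 : 'cV[F]_n')| = 0%N.
  by apply: eq_card0 => k; rewrite !inE mxE eqxx.
have := supp_leq (x := col j (cokermx N)); rewrite NC0 supp0 leqn0 => /(_ isT).
rewrite cards_eq0 => /eqP/setP/(_ i); rewrite !inE => /negbFE/eqP.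
by rewrite colE mulmxA -colE !mxE.
Qed.

Lemma leq_outside (V : 'M[F]_K) : (n' <= n)%N ->
  spanned N V -> (\rank V < \rank N)%N -> (#|outside M V| <= #|outside N V|)%N.
Proof.
move=> le_n'n; move: {2}(_ - _)%N (erefl (\rank N - \rank V)%N) => k.
elim: k V => [|k IHk] V def_k spV ltVN.
  by move: ltVN; rewrite -subn_gt0 def_k.
have outN (W : 'M[F]_K) : (\rank W < \rank N)%N -> exists j, j \in outside N W.
  move=> ltWN; apply/existsP; apply: contraLR ltWN; rewrite negb_exists -leqNgt.
  move=> /forallP inW; apply/mxrankS/row_subP => j.
  by have := inW j; rewrite inE negbK.
have leVN := spanned_sub spV.
have [j jV] := outN V ltVN.
have rkW i : i \in outside N V -> \rank (V + row i N)%MS = (\rank V).+1.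
  by rewrite inE => /rank_adds_row.
have leWN i : (V + row i N <= N)%MS by rewrite addsmx_sub leVN row_sub.
(* For [k = 0], [V] is a hyperplane of the row space of [N], and a functional turns both counts into
   supports. Then [supp_leq] applies: [n' <= n] and [\rank M <= \rank N] leave at most
   [n - \rank M + 1] rows of [N] outside [V]. *)
case: (posnP k) => [k0 | k_gt0].
  have leNW : (N <= V + row j N)%MS.
    rewrite -(geq_leqif (mxrank_leqif_sup (leWN j))) rkW //; lia.
  have j'V : ~~ (row j N <= V)%MS by rewrite inE in jV.
  have [x supp_x] := separating_functional j'V.
  have le_outN := card_outside spV; have leMN := mxrankS supp_leq_sub.
  have rkM := rank_leq_row M.
  rewrite -!supp_x ?(submx_trans supp_leq_sub) //; apply: supp_leq.
  by rewrite supp_x //; lia.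
pose adj i : 'M[F]_K := <<(V + row i N)%MS>>%MS.
pose P := undup (map adj (enum (outside N V))).
have memP W : W \in P -> exists2 i, i \in outside N V & W = adj i.
  by rewrite mem_undup => /mapP[k' ]; rewrite mem_enum => kV ->; exists k'.
have Pmem i : i \in outside N V -> adj i \in P.
  by move=> iV; rewrite mem_undup map_f ?mem_enum.
apply: (leq_outside_cover (P := P)).
- exact: undup_uniq.
(* As [k > 0], [V + row j N] is not yet the row space of [N], and a row outside it yields a second
   member of [P]. *)
- have [|i iW] := outN (V + row j N)%MS; first by rewrite rkW //; lia.
  have iV : i \in outside N V.
    by move: iW; rewrite !inE; apply: contra => /submx_trans; apply; apply: addsmxSl.
  rewrite -[leqLHS]/(size [:: adj j; adj i]).
  apply: uniq_leq_size.
    rewrite /= inE andbT; apply: contraL iW => /eqP eqW; rewrite inE negbK.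
    by rewrite -(genmxE (V + row j N)%MS) -/(adj j) eqW genmxE addsmxSr.
  by move=> W; rewrite !inE => /orP[]/eqP->; apply: Pmem.
- move=> _ /memP[i iV ->]; rewrite /adj !genmxE addsmxSl genmx_id.
  by split=> //; exact: rkW.
- move=> i iV; exists (adj i); first exact: Pmem.
  by rewrite /adj genmxE addsmxSr.
move=> _ /memP[i iV ->].
by rewrite !(eqmx_outside _ (genmxE _)); apply: IHk; rewrite ?rkW //;
  [lia | exact: spanned_adds | lia].
Qed.

Lemma outside0 l (L : 'M[F]_(l, K)) : (forall i, row i L != 0) -> #|outside L 0| = l.
Proof.
move=> nzL; rewrite -[RHS]card_ord; apply: eq_card => i.
by rewrite !inE submx0 nzL.
Qed.

Lemma leq_rows : (forall i, row i M != 0) -> (0 < \rank M)%N -> (n <= n')%N.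
Proof.
move=> nzM rkM; have [le_n'n | /ltnW //] := leqP n' n.
have : (#|outside M 0| <= #|outside N 0|)%N.
  apply: leq_outside => //; first exact: spanned0.
  by rewrite mxrank0 (leq_trans rkM) ?mxrankS ?supp_leq_sub.
by rewrite outside0 // => /leq_trans; apply; rewrite -[leqRHS]card_ord max_card.
Qed.

End PermutationLemma.

(** The line through a row of [N] contains at least as many rows of [M] as of [N], by [leq_outside].
    It contains at most one row of [M], by nonproportionality, hence exactly one of each. *)
Lemma permutation_lemma (F : fieldType) (K n : nat) (M N : 'M[F]_(n, K)) :
    (forall x : 'cV[F]_K, #|supp (N *m x)| <= n - \rank M + 1 ->
       #|supp (M *m x)| <= #|supp (N *m x)|)%N ->
    (1 < \rank M)%N -> (forall i j, row i M <= row j M -> i = j)%MS ->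
    (forall i, row i M != 0) -> (forall i, row i N != 0) ->
  exists (s : 'S_n) (c : 'I_n -> F),
    forall j, c j != 0 /\ row j N = c j *: row (s j) M.
Proof.
move=> supp_leq rkM neqM nzM nzN.
pose line j : 'M[F]_K := <<row j N>>%MS.
have leO j : (#|outside M (line j)| <= #|outside N (line j)|)%N.
  apply: leq_outside => //.
    by rewrite /spanned genmxE; apply: row_sub_span; rewrite !inE negbK genmxE.
  rewrite genmxE; apply: leq_ltn_trans (rank_leq_row _) (leq_trans rkM _).
  exact: mxrankS (supp_leq_sub supp_leq).
have exf j : exists i, (row i M <= row j N)%MS.
  apply/existsP; apply: contraLR (leO j).
  rewrite negb_exists -ltnNge => /forallP outM.
  have -> : outside M (line j) = setT by apply/setP => i; rewrite !inE genmxE outM.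
  have /proper_card // : outside N (line j) \proper setT.
  rewrite properT; apply/eqP => /setP/(_ j).
  by rewrite !inE genmxE submx_refl.
have [f fP] := fin_all_exists exf.
have cP j : exists c, row j N = c *: row (f j) M.
  have /sub_rVP[a def_a] := fP j; exists a^-1; rewrite def_a scalerA mulVf ?scale1r //.
  by apply: contraNneq (nzM (f j)) => a0; rewrite def_a a0 scale0r.
have [c def_c] := fin_all_exists cP.
have f_inj : injective f.
  move=> j j' eq_f; apply: contraTeq (leO j) => ne_jj'; rewrite -ltnNge.
  have le2 : (#|[set j; j']| <= #|~: outside N (line j)|)%N.
    apply/subset_leq_card/subsetP => k /set2P[]->; rewrite !inE negbK genmxE //.
    by rewrite def_c -eq_f scalemx_sub.
  have le1 : (#|~: outside M (line j)| <= #|[set f j]|)%N.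
    apply/subset_leq_card/subsetP => i; rewrite !inE negbK genmxE def_c => iM.
    by apply/eqP/neqM/(submx_trans iM)/scalemx_sub.
  move: le1 le2; rewrite cards2 ne_jj' cards1.
  have := cardsC (outside M (line j)); have := cardsC (outside N (line j)).
  rewrite card_ord; lia.
exists (perm f_inj), c => j; rewrite permE; split; last exact: def_c.
by apply: contraNneq (nzN j) => c0; rewrite def_c c0 scale0r.
Qed.

(** * Uniqueness of the factors *)

Lemma sliceE (F : fieldType) (p q n : nat) (X : 'M[F]_(p, n)) (Y : 'M[F]_(q, n))
    (d : 'cV[F]_n) i j :
  (X *m diag_mx d^T *m Y^T) i j = \sum_r X i r * d r 0 * Y j r.
Proof. by rewrite mul_mx_diag mxE; apply: eq_bigr => r _; rewrite !mxE. Qed.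

Section Decompositions.
Variables (F : fieldType) (n : nat).

Definition same_tensor (n' I J K : nat)
    (A : 'M[F]_(I, n)) (B : 'M[F]_(J, n)) (C : 'M[F]_(K, n))
    (A' : 'M[F]_(I, n')) (B' : 'M[F]_(J, n')) (C' : 'M[F]_(K, n')) :=
  forall i j k, \sum_r A i r * B j r * C k r = \sum_r A' i r * B' j r * C' k r.

(** Entrywise form of the conclusion of [cpd_unique]; the equation [a r * b r * c r = 1] also makes
    all scalars nonzero. *)
Definition same_factors (I J K : nat)
    (A : 'M[F]_(I, n)) (B : 'M[F]_(J, n)) (C : 'M[F]_(K, n))
    (A' : 'M[F]_(I, n)) (B' : 'M[F]_(J, n)) (C' : 'M[F]_(K, n)) :=
  exists (s : 'S_n) (a b c : 'I_n -> F), forall r,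
    [/\ a r * b r * c r = 1, forall i, A' i r = a r * A i (s r),
        forall j, B' j r = b r * B j (s r) & forall k, C' k r = c r * C k (s r)].

Section Modes.
Variables (n' I J K : nat).
Variables (A : 'M[F]_(I, n)) (B : 'M[F]_(J, n)) (C : 'M[F]_(K, n)).

Lemma same_tensor_swap (A' : 'M[F]_(I, n')) (B' : 'M[F]_(J, n')) (C' : 'M[F]_(K, n')) :
  same_tensor A B C A' B' C' -> same_tensor A C B A' C' B'.
Proof.
move=> eqT i k j; rewrite (eq_bigr _ (fun r _ => mulrAC _ _ _)) eqT.
by apply: eq_bigr => r _; rewrite mulrAC.
Qed.

Lemma same_tensor_rot (A' : 'M[F]_(I, n')) (B' : 'M[F]_(J, n')) (C' : 'M[F]_(K, n')) :
  same_tensor A B C A' B' C' -> same_tensor C A B C' A' B'.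
Proof.
move=> eqT k i j; transitivity (\sum_r A i r * B j r * C k r).
  by apply: eq_bigr => r _; rewrite mulrC mulrCA mulrA [_ * C k r]mulrC mulrA mulrAC.
by rewrite eqT; apply: eq_bigr => r _; rewrite mulrC mulrA.
Qed.

Lemma same_tensor_slice (A' : 'M[F]_(I, n')) (B' : 'M[F]_(J, n'))
    (C' : 'M[F]_(K, n')) x :
  same_tensor A B C A' B' C' ->
  A *m diag_mx (C^T *m x)^T *m B^T = A' *m diag_mx (C'^T *m x)^T *m B'^T.
Proof.
have slice_sum l (A1 : 'M[F]_(I, l)) (B1 : 'M[F]_(J, l)) (C1 : 'M[F]_(K, l)) i j :
    (A1 *m diag_mx (C1^T *m x)^T *m B1^T) i j =
    \sum_k (\sum_r A1 i r * B1 j r * C1 k r) * x k 0.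
  rewrite sliceE; under [RHS]eq_bigr do rewrite big_distrl /=.
  rewrite exchange_big; apply: eq_bigr => r _; rewrite !mxE mulrAC big_distrr /=.
  by apply: eq_bigr => k _; rewrite !mxE mulrA.
move=> eqT; apply/matrixP => i j; rewrite !slice_sum.
by apply: eq_bigr => k _; rewrite eqT.
Qed.

(** The common slice has rank at most [#|supp (C'^T *m x)|], which is below [m]; the minimum in the
    rank bound is therefore [#|supp (C^T *m x)|]. *)
Lemma supp_leq_slices (A' : 'M[F]_(I, n')) (B' : 'M[F]_(J, n')) (C' : 'M[F]_(K, n')) x :
    same_tensor A B C A' B' C' -> rank_bounded (n - \rank C + 2) A B ->
  (#|supp (C'^T *m x)| <= n - \rank C^T + 1 ->
   #|supp (C^T *m x)| <= #|supp (C'^T *m x)|)%N.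
Proof.
move=> /(same_tensor_slice x) eqS [_ /(_ (C^T *m x))]; rewrite eqS mxrank_tr.
have := rank_slice A' B' (C'^T *m x).
move: (\rank _) (\rank C) #|_| #|_| => r q s s'; lia.
Qed.

Lemma rank_bounded_gt1 (X : 'M[F]_(I, n)) (Y : 'M[F]_(J, n)) :
  rank_bounded (n - \rank C + 2) X Y -> (1 < \rank C^T)%N.
Proof. by case; rewrite mxrank_tr; have := rank_leq_col C; lia. Qed.

Lemma leq_terms (A' : 'M[F]_(I, n')) (B' : 'M[F]_(J, n')) (C' : 'M[F]_(K, n')) :
    same_tensor A B C A' B' C' -> rank_bounded (n - \rank C + 2) A B ->
  nonzero_cols C -> (n <= n')%N.
Proof.
move=> eqT AB nzC; apply: (@leq_rows _ _ _ _ C^T C'^T).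
- by move=> x; apply: supp_leq_slices eqT AB.
- by move=> r; rewrite -tr_col trmx_eq0 nzC.
- exact: ltnW (rank_bounded_gt1 AB).
Qed.

End Modes.

Lemma factor_unique (I J K : nat)
    (A A' : 'M[F]_(I, n)) (B B' : 'M[F]_(J, n)) (C C' : 'M[F]_(K, n)) :
    same_tensor A B C A' B' C' -> rank_bounded (n - \rank C + 2) A B ->
    (forall i j, row i C^T <= row j C^T -> i = j)%MS ->
    nonzero_cols C -> nonzero_cols C' ->
  exists (s : 'S_n) (c : 'I_n -> F), forall r,
    c r != 0 /\ forall k, C' k r = c r * C k (s r).
Proof.
move=> eqT AB neqC nzC nzC'.
have [|||r|r|s [c def_c]] := @permutation_lemma _ _ _ C^T C'^T.
- by move=> x; apply: supp_leq_slices eqT AB.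
- exact: rank_bounded_gt1 AB.
- exact: neqC.
- by rewrite -tr_col trmx_eq0 nzC.
- by rewrite -tr_col trmx_eq0 nzC'.
exists s, c => r; have [nz_c /rowP eq_r] := def_c r; split=> // k.
by have := eq_r k; rewrite !mxE.
Qed.

(** * Matching the permutations of two factors and recovering the third *)

Section SharedMode.
Variables (I J K : nat).
Variables (A A' : 'M[F]_(I, n)) (B B' : 'M[F]_(J, n)) (C C' : 'M[F]_(K, n)).
Hypothesis eqT : same_tensor A B C A' B' C'.
Hypothesis AB : rank_bounded (n - \rank C + 2) A B.
Hypothesis neqC : forall i j, (row i C^T <= row j C^T)%MS -> i = j.
Hypothesis nzC : nonzero_cols C.
Variables (s t : 'S_n) (b c : 'I_n -> F).
Hypothesis nz_b : forall r, b r != 0.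
Hypothesis nz_c : forall r, c r != 0.
Hypothesis def_B' : forall r j, B' j r = b r * B j (s r).
Hypothesis def_C' : forall r k, C' k r = c r * C k (t r).

Lemma mul_C'E (x : 'cV[F]_K) r : (C'^T *m x) r 0 = c r * (C^T *m x) (t r) 0.
Proof.
by rewrite !mxE big_distrr /=; apply: eq_bigr => k _; rewrite !mxE def_C' mulrA.
Qed.

Lemma supp_C' (x : 'cV[F]_K) r : (r \in supp (C'^T *m x)) = (t r \in supp (C^T *m x)).
Proof. by rewrite !inE mul_C'E mulf_eq0 (negPf (nz_c r)). Qed.

Lemma same_perm : s = t.
Proof.
apply/permP => r; apply/eqP; apply: contraT => ne_st.
have [|x [le_x tx]] := @separating_row _ _ _ C^T [set s r] (t r).
  rewrite /row_span big_set1 genmxE; apply: contra ne_st => /neqC->.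
  exact: eqxx.
move/(_ (s r) (set11 _)); rewrite mxrank_tr in le_x.
set y := C^T *m x in tx le_x *.
have lt_ym : (#|supp y| < n - \rank C + 2)%N by rewrite addnS ltnS.
set y' := C'^T *m x.
have le_y'y : (#|supp y'| <= #|supp y|)%N.
  rewrite -(card_imset _ (@perm_inj _ t)); apply/subset_leq_card.
  apply/subsetP => _ /imsetP[k ky' ->].
  by rewrite -supp_C'.
have eqS : A *m (diag_mx y^T *m B^T) = A' *m (diag_mx y'^T *m B'^T).
  by rewrite !mulmxA; apply: same_tensor_slice.
have rkG : (#|supp y| <= \rank (A *m (diag_mx y^T *m B^T)))%N.
  by case: AB => _ /(_ y); rewrite mulmxA (minn_idPl _) // ltnW.
(* The row space of the slice lies in that of [diag_mx y'^T *m B'^T], whose rank is at most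
   [#|supp y'| <= #|supp y|], hence at most that of the slice. So the two row spaces coincide. *)
have leHG : (diag_mx y'^T *m B'^T <= A *m (diag_mx y^T *m B^T))%MS.
  rewrite eqS -(geq_leqif (mxrank_leqif_sup (submxMl _ _))) -eqS.
  apply: leq_trans rkG; apply: leq_trans (mxrankM_maxl _ _) _.
  exact: leq_trans (rank_diag_mx _) le_y'y.
have def_row : row r (diag_mx y'^T *m B'^T) = (y' r 0 * b r) *: row (s r) B^T.
  by apply/rowP => j; rewrite mul_diag_mx !mxE def_B' mulrA.
have /submxP[w def_w] : (row (s r) B^T <= diag_mx y^T *m B^T)%MS.
  have := submx_trans (row_sub r _) (submx_trans leHG (submxMl _ _)).
  rewrite def_row eqmx_scale // mulf_neq0 //.
  by have := tx; rewrite -supp_C' inE.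
have sub_w : supp (w *m diag_mx y^T)^T \subset supp y.
  apply/subsetP => k; rewrite !inE mul_mx_diag !mxE; apply: contra => /eqP->.
  by rewrite mulr0.
(* Column [s r] of [B] is a combination of the fewer than [m] columns indexed by [supp y], so [s r]
   itself would be in [supp y], against the choice of [x]. *)
move/negP; case; apply: (subsetP sub_w); apply: rank_bounded_col AB _ _.
  by apply: trmx_inj; rewrite tr_col def_w mulmxA -[B in RHS]trmxK -trmx_mul trmxK.
by apply: leq_ltn_trans lt_ym; apply: subset_leq_card.
Qed.

Lemma third_factor r i : A i (s r) = c r * b r * A' i r.
Proof.
have [|x [le_x sx _]] := @separating_row _ _ _ C^T set0 (s r).
  by rewrite /row_span big_set0 submx0 -tr_col trmx_eq0 nzC.
rewrite mxrank_tr in le_x; set y := C^T *m x in sx le_x *.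
have le_ym : (#|supp y| <= n - \rank C + 2)%N by rewrite addnS ltnW.
(* [z k] is the defect of the claimed formula at column [k = s r]. Equality of row [i] of the two
   slices reads [B *m u = 0], with [u] supported in [supp y], so independence gives [u = 0]. *)
pose z k := A i k - c (s^-1%g k) * b (s^-1%g k) * A' i (s^-1%g k).
pose u : 'cV[F]_n := \col_k (y k 0 * z k).
have sub_u : supp u \subset supp y.
  by apply/subsetP => k; rewrite !inE mxE; apply: contra => /eqP->; rewrite mul0r.
have Bu0 : B *m u = 0.
  apply/colP => j; have /matrixP/(_ i j) := same_tensor_slice x eqT.
  rewrite !sliceE => eqS; rewrite !mxE; under eq_bigr do rewrite mxE mulrBr mulrBr.
  rewrite sumrB; apply/eqP; rewrite subr_eq0; apply/eqP.
  transitivity (\sum_k A i k * y k 0 * B j k).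
    by apply: eq_bigr => k _; rewrite mulrC [y k 0 * _]mulrC.
  rewrite eqS [RHS](reindex_inj (@perm_inj _ s)); apply: eq_bigr => k _ /=.
  rewrite permK mul_C'E -same_perm def_B' -/y.
  ring.
have : u = 0.
  exact: rank_bounded_indep AB Bu0 (leq_trans (subset_leq_card sub_u) le_ym).
move/colP/(_ (s r)); rewrite mxE [RHS]mxE /z permK => /eqP; rewrite mulf_eq0 subr_eq0.
by rewrite inE in sx; rewrite (negPf sx) => /eqP.
Qed.

Lemma same_factors_shared : same_factors A B C A' B' C'.
Proof.
exists s, (fun r => (c r * b r)^-1), b, c => r.
split=> [|i|j|k]; last by rewrite def_C' same_perm.
  by rewrite -mulrA [b r * _]mulrC mulVf ?mulf_neq0.
  by rewrite third_factor mulKf ?mulf_neq0.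
exact: def_B'.
Qed.

End SharedMode.

(** Each bound serves twice: [AB] determines [C] and makes the columns of [B] pairwise
    nonproportional, since [m >= 2]; [AC] does the same with [B] and [C] exchanged. *)
Lemma cpd_factors (I J K : nat)
    (A A' : 'M[F]_(I, n)) (B B' : 'M[F]_(J, n)) (C C' : 'M[F]_(K, n)) :
    same_tensor A B C A' B' C' ->
    rank_bounded (n - \rank C + 2) A B -> rank_bounded (n - \rank B + 2) A C ->
    nonzero_cols B -> nonzero_cols C -> nonzero_cols B' -> nonzero_cols C' ->
  same_factors A B C A' B' C'.
Proof.
move=> eqT AB AC nzB nzC nzB' nzC'.
have neqB i j : (row i B^T <= row j B^T)%MS -> i = j.
  by apply: rank_bounded_neq AB _; rewrite addn2.
have neqC i j : (row i C^T <= row j C^T)%MS -> i = j.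
  by apply: rank_bounded_neq AC _; rewrite addn2.
have [s [b bP]] := factor_unique (same_tensor_swap eqT) AC neqB nzB nzB'.
have [t [c cP]] := factor_unique eqT AB neqC nzC nzC'.
apply: (same_factors_shared eqT AB neqC nzC (s := s) (t := t) (b := b) (c := c)).
- by move=> r; case: (bP r).
- by move=> r; case: (cP r).
- by move=> r; case: (bP r).
- by move=> r; case: (cP r).
Qed.

End Decompositions.

(** * From entrywise identities to tensor rank and matrix factors *)

Lemma polyadicE (F : fieldType) (I J K n : nat)
    (A : 'M[F]_(I, n)) (B : 'M[F]_(J, n)) (C : 'M[F]_(K, n)) i j k :
  polyadic A B C (i, j, k) = \sum_r A i r * B j r * C k r.
Proof. by rewrite sum_ffunE; apply: eq_bigr => r _; rewrite ffunE !mxE. Qed.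

Lemma polyadic_same_tensor (F : fieldType) (I J K n n' : nat) (T : tensor F I J K)
    (A : 'M[F]_(I, n)) (B : 'M[F]_(J, n)) (C : 'M[F]_(K, n))
    (A' : 'M[F]_(I, n')) (B' : 'M[F]_(J, n')) (C' : 'M[F]_(K, n')) :
  is_polyadic T A B C -> is_polyadic T A' B' C' -> same_tensor A B C A' B' C'.
Proof.
by move=> [_ _ _ ->] [_ _ _ /ffunP eqT] i j k; rewrite -!polyadicE.
Qed.

Lemma same_factors_rot (F : fieldType) (I J K n : nat)
    (A A' : 'M[F]_(I, n)) (B B' : 'M[F]_(J, n)) (C C' : 'M[F]_(K, n)) :
  same_factors A B C A' B' C' -> same_factors B C A B' C' A'.
Proof.
move=> [s [a [b [c abcP]]]]; exists s, b, c, a => r.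
by have [abc1 defA defB defC] := abcP r; split; rewrite // mulrC mulrA.
Qed.

(** Serves to compare two arbitrary decompositions, as [cpd_unique] demands, through the given one,
    which alone carries the rank bounds. *)
Lemma same_factors_eucl (F : fieldType) (I J K n : nat)
    (A A1 A2 : 'M[F]_(I, n)) (B B1 B2 : 'M[F]_(J, n)) (C C1 C2 : 'M[F]_(K, n)) :
  same_factors A B C A1 B1 C1 -> same_factors A B C A2 B2 C2 ->
  same_factors A1 B1 C1 A2 B2 C2.
Proof.
move=> [s1 [a1 [b1 [c1 P1]]]] [s2 [a2 [b2 [c2 P2]]]].
pose s := (s2 * s1^-1)%g; have s1s r : s1 (s r) = s2 r by rewrite permM permKV.
have nz1 r : [&& a1 r != 0, b1 r != 0 & c1 r != 0].
  have [abc1 _ _ _] := P1 r; have := oner_neq0 F.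
  by rewrite -abc1 !mulf_eq0 !negb_or -andbA.
exists s, (fun r => a2 r / a1 (s r)), (fun r => b2 r / b1 (s r)),
  (fun r => c2 r / c1 (s r)) => r.
have [abc1 A1E B1E C1E] := P1 (s r); have [abc2 A2E B2E C2E] := P2 r.
have /and3P[nz_a nz_b nz_c] := nz1 (s r); split=> [|i|j|k].
- by rewrite !mulf_div abc1 abc2 divr1.
- by rewrite A2E A1E s1s mulrA divfK.
- by rewrite B2E B1E s1s mulrA divfK.
- by rewrite C2E C1E s1s mulrA divfK.
Qed.

Lemma same_factors_mx (F : fieldType) (I J K n : nat)
    (A A' : 'M[F]_(I, n)) (B B' : 'M[F]_(J, n)) (C C' : 'M[F]_(K, n)) :
    same_factors A B C A' B' C' ->
  exists P LA LB LC : 'M[F]_n,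
    [/\ is_perm_mx P,
        [/\ is_diag_mx LA, is_diag_mx LB & is_diag_mx LC],
        [/\ LA \in unitmx, LB \in unitmx & LC \in unitmx],
        [/\ A' = A *m P *m LA, B' = B *m P *m LB & C' = C *m P *m LC]
      & LA *m LB *m LC = 1%:M].
Proof.
move=> [s [a [b [c abcP]]]].
have diag_unit (d : 'I_n -> F) :
    (forall r, d r != 0) -> diag_mx (\row_r d r) \in unitmx.
  move=> nz_d; rewrite unitmxE det_diag unitfE; apply/prodf_neq0 => r _.
  by rewrite mxE.
have nz_abc r : [&& a r != 0, b r != 0 & c r != 0].
  have [abc1 _ _ _] := abcP r; have := oner_neq0 F.
  by rewrite -abc1 !mulf_eq0 !negb_or -andbA.
have factorE p (X X' : 'M[F]_(p, n)) (d : 'I_n -> F) :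
    (forall r i, X' i r = d r * X i (s r)) ->
    X' = X *m perm_mx s^-1%g *m diag_mx (\row_r d r).
  move=> defX; apply/matrixP => i r.
  by rewrite -col_permE mul_mx_diag !mxE defX mulrC.
(* Right multiplication by [perm_mx s^-1] puts column [s r] in position [r], whence the inverse. *)
exists (perm_mx s^-1%g), (diag_mx (\row_r a r)), (diag_mx (\row_r b r)),
  (diag_mx (\row_r c r)); split.
- exact: perm_mx_is_perm.
- by split; apply: diag_mx_is_diag.
- by split; apply: diag_unit => r; case/and3P: (nz_abc r).
- by split; apply: factorE => r; case: (abcP r).
apply/matrixP => i j; rewrite !mul_mx_diag !mxE.
have [<- | _] := eqVneq i j; last by rewrite !mulr0n !mul0r.
by have [abc1 _ _ _] := abcP i; rewrite !mulr1n.
Qed.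

Lemma cpd_unique_of_same_factors (F : fieldType) (I J K n : nat) (T : tensor F I J K)
    (A : 'M[F]_(I, n)) (B : 'M[F]_(J, n)) (C : 'M[F]_(K, n)) :
    is_polyadic T A B C ->
    (forall k (A' : 'M[F]_(I, k)) (B' : 'M[F]_(J, k)) (C' : 'M[F]_(K, k)),
       is_polyadic T A' B' C' -> (n <= k)%N) ->
    (forall (A' : 'M[F]_(I, n)) (B' : 'M[F]_(J, n)) (C' : 'M[F]_(K, n)),
       is_polyadic T A' B' C' -> same_factors A B C A' B' C') ->
  has_tensor_rank T n /\ cpd_unique T.
Proof.
move=> T_ABC min_n uniq_n; split; first split; first by exists A, B, C.
  by move=> k [A' [B' [C' /min_n]]].
move=> k A1 A2 B1 B2 C1 C2 [_ min_k] T1 T2.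
have eq_kn : k = n.
  apply/eqP; rewrite eqn_leq (min_n _ _ _ _ T1) andbT; apply: min_k.
  by exists A, B, C.
subst k; apply: same_factors_mx.
exact: same_factors_eucl (uniq_n _ _ _ T1) (uniq_n _ _ _ T2).
Qed.

Lemma cpd_unique_condU (F : fieldType) (I J K R : nat) (T : tensor F I J K)
    (A : 'M[F]_(I, R)) (B : 'M[F]_(J, R)) (C : 'M[F]_(K, R)) :
    is_polyadic T A B C ->
    let cond1 := condU (R - \rank A + 2) B C in
    let cond2 := condU (R - \rank B + 2) C A in
    let cond3 := condU (R - \rank C + 2) A B in
    (cond1 /\ cond2) \/ (cond2 /\ cond3) \/ (cond1 /\ cond3) ->
  has_tensor_rank T R /\ cpd_unique T.
Proof.
move=> T_ABC; have [nzA nzB nzC _] := T_ABC => cond1 cond2 cond3 conds.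
have eqT k (A' : 'M[F]_(I, k)) (B' : 'M[F]_(J, k)) (C' : 'M[F]_(K, k)) :
    is_polyadic T A' B' C' -> same_tensor A B C A' B' C'.
  exact: polyadic_same_tensor.
have eqT1 k A' B' C' T' := same_tensor_rot (eqT k A' B' C' T').
have eqT2 k A' B' C' T' := same_tensor_rot (eqT1 k A' B' C' T').
apply: (cpd_unique_of_same_factors T_ABC) => [k A' B' C' T' | A' B' C' T'].
  case: conds => [[_ /condU_rank_bounded CA] |
    [[_ /condU_rank_bounded AB] | [_ /condU_rank_bounded AB]]].
  - exact: leq_terms (eqT1 _ _ _ _ T') CA nzB.
  - exact: leq_terms (eqT _ _ _ _ T') AB nzC.
  - exact: leq_terms (eqT _ _ _ _ T') AB nzC.
have [nzA' nzB' nzC' _] := T'.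
(* In each case a cyclic rotation of the modes brings the matrix common to both conditions ([C], [A]
   and [B] in turn) to the first place, as [cpd_factors] expects. *)
case: conds => [[]|[[]|[]]] /condU_rank_bounded U /condU_rank_bounded V.
- apply: same_factors_rot.
  exact: cpd_factors (eqT1 _ _ _ _ T') V (rank_bounded_sym U) nzA nzB nzA' nzB'.
- exact: cpd_factors (eqT _ _ _ _ T') V (rank_bounded_sym U) nzB nzC nzB' nzC'.
- do 2!apply: same_factors_rot.
  exact: cpd_factors (eqT2 _ _ _ _ T') U (rank_bounded_sym V) nzC nzA nzC' nzA'.
Qed.

Theorem proposition1p26 (Re : realType) (k : scalar_kind) (I J K R : nat)
    (T : tensor (scalars Re k) I J K)
    (A : 'M[scalars Re k]_(I, R)) (B : 'M[scalars Re k]_(J, R))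
    (C : 'M[scalars Re k]_(K, R)) (hT : is_polyadic T A B C) :
  let mA := (R - \rank A + 2)%N in
  let mB := (R - \rank B + 2)%N in
  let mC := (R - \rank C + 2)%N in
  let cond1 := condU mA B C in
  let cond2 := condU mB C A in
  let cond3 := condU mC A B in
  (cond1 /\ cond2) \/ (cond2 /\ cond3) \/ (cond1 /\ cond3) ->
  has_tensor_rank T R /\ cpd_unique T.
Proof. exact: cpd_unique_condU hT. Qed.
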